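(* There exists a measurable set $\mathcal{S}\subset\mathbb{T}$ of positive Lebesgue measure with the following property. Let $\alpha<1$ and let $\Lambda\subset\mathbb{Z}$ be such that there are a constant $C>0$ and arbitrarily large $N\in\mathbb{N}$ for which $\Lambda$ contains an arithmetic progression $\{M+\ell, M+2\ell,\ldots,M+N\ell\}$ of length $N$ with some $M\in\mathbb{Z}$ and step $\ell\in\mathbb{N}$ satisfying $\ell\le C N^{\alpha}$. Then $E(\Lambda)=\{e^{i\lambda t}\}_{\lambda\in\Lambda}$ is not a Riesz sequence in $L^{2}(\mathcal{S})$.
   Context: $\mathbb{T}=\mathbb{R}/2\pi\mathbb{Z}$, identified with $[-\pi,\pi)$. For $\Lambda\subset\mathbb{Z}$, $E(\Lambda):=\{e^{i\lambda t}\}_{\lambda\in\Lambda}$. A sequence $\{\varphi_i\}_{i\in I}$ in a Hilbert space $\mathcal{H}$ is a Riesz sequence if there are constants $A,B>0$ such that $A\sum_{i}|c_i|^2\le \|\sum_i c_i\varphi_i\|^2\le B\sum_i|c_i|^2$ for every finite sequence of scalars $\{c_i\}$. The space $L^2(\mathcal{S})$ is taken with the norm $\|f\|^2=\int_{\mathcal{S}}|f(t)|^2\,\frac{dt}{2\pi}$. *)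

(* Defs.v *)
From HB Require Import structures.
From mathcomp Require Import all_boot all_order all_algebra.
From mathcomp Require Import all_classical all_reals all_analysis.
From mathcomp Require Import complex.
Set Implicit Arguments. Unset Strict Implicit. Unset Printing Implicit Defensive.
Import Order.TTheory GRing.Theory Num.Theory.
Local Open Scope classical_set_scope.
Local Open Scope ring_scope.

Definition expi (R : realType) (lam : int) (t : R) : R[i] :=
  Complex (cos (lam%:~R * t)) (sin (lam%:~R * t)).

Definition L2norm2_trig (R : realType) (S : set R) (s : seq int) (c : int -> R[i])
  : \bar R :=
  ((2 * pi)^-1)%:E *
  (\int[@lebesgue_measure R]_(t in S)
      ((Normc.normc (\sum_(lam <- s) c lam * expi lam t)) ^+ 2)%:E)%E.

Definition riesz_seq_exp (R : realType) (S : set R) (Lam : set int) : Prop :=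
  exists A B : R, 0 < A /\ 0 < B /\
    forall (s : seq int) (c : int -> R[i]),
      uniq s -> {subset s <= Lam} ->
      let sq := \sum_(lam <- s) (Normc.normc (c lam)) ^+ 2 in
      ((A * sq)%:E <= L2norm2_trig S s c)%E /\ (L2norm2_trig S s c <= (B * sq)%:E)%E.

(* Main.v *)
Require Import Defs.
From HB Require Import structures.
From mathcomp Require Import all_boot all_order all_algebra.
From mathcomp Require Import all_classical all_reals all_analysis.
From mathcomp Require Import complex.
From mathcomp Require Import ring lra zify.
Import Order.TTheory GRing.Theory Num.Theory.
Import numFieldNormedType.Exports.
Local Open Scope classical_set_scope.
Local Open Scope ring_scope.

(** Remove from [[-pi, pi)] every [t] for which some step [1 <= l <= 2^k] has
    [l t] within [gap k ~ 1 / (2^k k^2)] of [2 pi Z].  For a fixed pair [(k, l)]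
    the removed set has measure O(gap k), so level [k] costs O(1 / k^2) and a
    set of positive measure remains.  On it [|e^(ilt) - 1|] is at least of order
    [l^-(1 + eps)] for every [eps > 0].

    Against a progression of length [N] and step [l <= C N^alpha], test with the
    [m]-th power of the Dirichlet kernel [1 + z + ... + z^(n-1)], [z = e^(ilt)],
    [n ~ N / m].  On the set it is bounded by [(2 / |z - 1|)^m], while its value
    [n^m] at [z = 1] and Cauchy-Schwarz bound the coefficient norm from below by
    [n^(2m) / N].  A lower Riesz bound [A] thus forces
    [A (n |z - 1|)^(2m) <= 4^m N], and [n |z - 1|] grows like a positive power of
    [N], so a large [m] gives a contradiction.  The power [m] replaces an
    integral estimate by a pointwise one. *)

(** * Moduli of complex exponentials and distance to the nearest period *)

Lemma sin_ge_quarter (R : realType) (y : R) :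
  0 <= y <= pi / 2 -> y / 4 <= sin y.
Proof.
move=> /andP[y0 yh]; have h2 := pihalf_lt2 R; have hpi := @pi_gt0 R.
have [->|yn0] := eqVneq y 0; first by rewrite sin0 mul0r.
have {yn0 y0} y0 : 0 < y by rewrite lt_neqAle eq_sym yn0.
have s0 : 0 <= sin y by apply: sin_ge0_pi; apply/andP; split; lra.
have := cos2Dsin2 y.
(* If [cos y <= 1/2], then [sin y] is at least sqrt(3)/2, while [y / 4 < 1/2]. Otherwise the mean
   value theorem gives [sin y = y cos c] with [cos c > 1/2]. *)
have [cle|clt] := lerP (cos y) (1/2).
  have c0 : 0 <= cos y by apply: cos_ge0_pihalf; apply/andP; split; lra.
  nra.
have [|c] := @MVT R sin cos 0 y y0 (fun x _ => is_derive_sin x).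
  by apply: continuous_subspaceT => x; exact: continuous_sin.
rewrite in_itv /= sin0 !subr0 => /andP[c0 cy] -> _.
have : cos y < cos c by rewrite ltr_cos// in_itv /=; apply/andP; split; lra.
nra.
Qed.

Lemma normc_ge0 (R : rcfType) (z : R[i]) : 0 <= Normc.normc z.
Proof. by case: z => a b /=; exact: sqrtr_ge0. Qed.

Lemma normcX (R : rcfType) (z : R[i]) n :
  Normc.normc (z ^+ n) = Normc.normc z ^+ n.
Proof.
elim: n => [|n IHn]; first by rewrite !expr0 Normc.normc1.
by rewrite !exprS Normc.normcM IHn.
Qed.

Lemma normc_sum (R : rcfType) (I : Type) (r : seq I) (F : I -> R[i]) :
  Normc.normc (\sum_(i <- r) F i) <= \sum_(i <- r) Normc.normc (F i).
Proof.
elim: r => [|i r IHr]; first by rewrite !big_nil Normc.normc0.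
rewrite !big_cons; apply: (le_trans (le_normcD _ _)).
by rewrite lerD2l.
Qed.

Lemma normc_nat (R : rcfType) n : Normc.normc (n%:R : R[i]) = n%:R.
Proof. 
by have := @normcMn R 1 n; rewrite Normc.normc1.
Qed.

Lemma normc_sqr (R : rcfType) (z : R[i]) :
  Normc.normc z ^+ 2 = complex.Re z ^+ 2 + complex.Im z ^+ 2.
Proof. by case: z => a b /=; rewrite sqr_sqrtr// addr_ge0// sqr_ge0. Qed.

Lemma expi0 (R : realType) (t : R) : expi 0 t = 1.
Proof. by rewrite /expi mul0r cos0 sin0. Qed.

Lemma expiD (R : realType) (a b : int) (t : R) :
  expi (a + b) t = expi a t * expi b t.
Proof.
by rewrite /expi intrD mulrDl cosD sinD; simpc; congr Complex; ring.
Qed.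

Lemma expiMn (R : realType) (k l : nat) (t : R) :
  expi (k * l)%:Z t = expi l%:Z t ^+ k.
Proof.
elim: k => [|k IHk]; first by rewrite mul0n expr0 expi0.
by rewrite mulSn PoszD expiD IHk exprS.
Qed.

Lemma normc_expi (R : realType) (a : int) (t : R) :
  Normc.normc (expi a t) = 1.
Proof. by rewrite /= cos2Dsin2 sqrtr1. Qed.

Lemma normc_expiB1 (R : realType) (a : int) (t : R) :
  Normc.normc (expi a t - 1) = 2 * `|sin (a%:~R * t / 2)|.
Proof.
set x := a%:~R * t.
apply/eqP; rewrite -(@eqrXn2 _ 2)// ?normc_ge0// ?mulr_ge0//.
rewrite exprMn real_normK ?num_real// normc_sqr /= -/x.
set y := x / 2; have -> : x = y + y by rewrite /y; field.
rewrite cosD sinD subr0; apply/eqP.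
(* Expanding the squared modulus produces [sin y ^+ 4], so the rewriting modulo the Pythagorean
   identity is supplied for that power too. *)
have h := sin2cos2 y; have h4 : sin y ^+ 4 = (1 - cos y ^+ 2) ^+ 2.
  by rewrite -h -exprM.
by ring: h h4.
Qed.

(** The product telescopes to [z ^+ n - 1]; the product form avoids dividing by zero at [z = 1]. *)
Lemma normc_geometric_sum (R : rcfType) (z : R[i]) n :
  Normc.normc z = 1 ->
  Normc.normc (\sum_(i < n) z ^+ i) * Normc.normc (z - 1) <= 2.
Proof.
move=> z1; rewrite mulrC -Normc.normcM -subrX1.
apply: (le_trans (le_normcD _ _)).
by rewrite normcN normcX z1 expr1n Normc.normc1.
Qed.

(** Cauchy-Schwarz against the constant vector, read off from the nonnegativity of the squared
    deviations from the mean. *)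
Lemma sqr_sum_le (R : realFieldType) n (a : 'I_n -> R) :
  (\sum_i a i) ^+ 2 <= n%:R * \sum_i a i ^+ 2.
Proof.
case: n a => [|n] a; first by rewrite !big_ord0 expr0n mul0r.
set s := \sum_i a i; set q := \sum_i a i ^+ 2.
have n0 : 0 < n.+1%:R :> R by rewrite ltr0n.
have : 0 <= \sum_i (a i - s / n.+1%:R) ^+ 2 by apply: sumr_ge0 => i _; exact: sqr_ge0.
rewrite (eq_bigr (fun i => a i ^+ 2 + ((- 2 * (s / n.+1%:R)) * a i + (s / n.+1%:R) ^+ 2))); last first.
  by move=> i _; ring.
rewrite big_split big_split /= -mulr_sumr sumr_const card_ord -/s -/q -(mulr_natr (_ ^+ 2)) => h.
have := mulr_ge0 (ltW n0) h.
have -> : n.+1%:R * (q + (-2 * (s / n.+1%:R) * s + (s / n.+1%:R) ^+ 2 * n.+1%:R)) =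
  n.+1%:R * q - s ^+ 2 by field; lra.
by rewrite subr_ge0.
Qed.

Lemma normr_sin_addMpi (R : realType) (x : R) (j : int) :
  `|sin (x + pi * j%:~R)| = `|sin x|.
Proof.
have nat_case (n : nat) (y : R) : `|sin (y + pi * n%:R)| = `|sin y|.
  elim: n => [|n IHn]; first by rewrite mulr0 addr0.
  by rewrite -natr1 mulrDr mulr1 addrA sinDpi normrN.
case: j => n; first exact: nat_case.
rewrite NegzE -[in RHS](subrK (pi * n.+1%:R) x) nat_case; congr `|sin _|.
by rewrite rmorphN /= mulrN.
Qed.

Lemma normc_expiB1_ge (R : realType) (a j : int) (t : R) :
  `|a%:~R * t - 2 * pi * j%:~R| <= pi ->
  `|a%:~R * t - 2 * pi * j%:~R| / 4 <= Normc.normc (expi a t - 1).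
Proof.
set y := _ - _ => hy; rewrite normc_expiB1.
have -> : a%:~R * t / 2 = y / 2 + pi * j%:~R by rewrite /y; field.
rewrite normr_sin_addMpi.
have hy0 := normr_ge0 y.
have -> : `|sin (y / 2)| = `|sin (`|y| / 2)|.
  have [y0|/ltW y0] := lerP 0 y; first by rewrite (ger0_norm y0).
  by rewrite (ler0_norm y0) mulNr sinN normrN.
have : `|y| / 2 / 4 <= sin (`|y| / 2).
  by apply: sin_ge_quarter; apply/andP; split; lra.
by move=> h; have := ler_norm (sin (`|y| / 2)); lra.
Qed.

Lemma nearest_period (R : realType) (l : nat) (t : R) :
  (0 < l)%N -> - pi <= t < pi ->
  exists2 j : nat, (j < 2 * l + 1)%N &
    `|l%:R * t - 2 * pi * (j%:Z - l%:Z)%:~R| <= pi.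
Proof.
move=> l0 /andP[t1 t2]; have hpi := @pi_gt0 R.
have lR : 1 <= l%:R :> R by rewrite ler1n.
(* The floor of [u] is the multiple of 2 pi nearest to [l t]. As [t] lies in [-pi, pi), it is
   between [-l] and [l], and adding [l] makes it a natural index. *)
set u := (l%:R * t + pi) / (2 * pi).
have uE : 2 * pi * u = l%:R * t + pi by rewrite /u; field; lra.
have /andP[f1 f2] := floor_itv u.
set f := Num.floor u in f1 f2.
have fl : - l%:Z <= f.
  rewrite /f floor_ge_int rmorphN /= -(ler_pM2l (_ : 0 < 2 * pi)); last lra.
  rewrite uE -pmulrn; nra.
have fu : f <= l%:Z.
  suff : f%:~R < (l%:Z + 1)%:~R :> R by rewrite ltr_int; lia.
  apply: (le_lt_trans f1).
  rewrite -(ltr_pM2l (_ : 0 < 2 * pi)); last lra.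
  rewrite uE rmorphD /= -pmulrn; nra.
have fE : f = (absz (f + l%:Z))%:Z - l%:Z by lia.
exists (absz (f + l%:Z)); first lia.
rewrite -fE ler_norml; rewrite rmorphD /= in f2.
by apply/andP; split; nra.
Qed.

(** * The nonresonant set and its measure *)

Lemma lebesgue_measure_circle (R : realType) :
  @lebesgue_measure R [set` `[- pi, pi[%R] = (2 * pi)%:E.
Proof.
have hpi := @pi_gt0 R.
rewrite lebesgue_measure_itv /= lte_fin ifT; last lra.
by rewrite -EFinD; congr EFin; lra.
Qed.

(** The power of 2 pays for the 2^k steps of level [k], and the quadratic factor makes the costs
    telescope. The leading 2 brings the total cost down to 3, below 2 pi already by [pi >= 2]. *)
Definition gap (R : realType) (k : nat) : R :=
  (2 * 2 ^+ k * (k%:R + 1) * (k%:R + 2))^-1.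

Lemma gap_gt0 (R : realType) k : 0 < gap R k.
Proof.
rewrite /gap invr_gt0; have k0 : 0 <= k%:R :> R by [].
by rewrite !mulr_gt0 ?exprn_gt0//; lra.
Qed.

(* The index [l] stands for the step [l.+1], and [j] in [0, 2 l.+1] for the
   multiple [j - l.+1] of [2 pi]. *)
Definition resonant_arc (R : realType) (k l j : nat) : set R :=
  ball (2 * pi * (j%:Z - l.+1%:Z)%:~R / l.+1%:R) (gap R k / l.+1%:R).

Definition resonant_arcs (R : realType) (k l : nat) : set R :=
  \big[setU/set0]_(j < 2 * l.+1 + 1) resonant_arc R k l j.

Definition resonant_set (R : realType) (k : nat) : set R :=
  \big[setU/set0]_(l < 2 ^ k) resonant_arcs R k l.

Definition nonresonant_set (R : realType) : set R :=
  [set` `[- pi, pi[%R] `\` \bigcup_k resonant_set R k.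

Lemma measurable_resonant_set (R : realType) k : measurable (resonant_set R k).
Proof.
apply: bigsetU_measurable => l _; apply: bigsetU_measurable => j _.
exact: measurable_realfun.measurable_ball.
Qed.

Lemma measurable_nonresonant_set (R : realType) :
  measurable (nonresonant_set R).
Proof.
apply: measurableD => //.
by apply: bigcup_measurable => k _; exact: measurable_resonant_set.
Qed.

(** A step [l] has [2 l + 1] arcs of length [2 gap k / l], hence costs at most [6 gap k]. Summing
    over 2^k steps cancels the power of 2, and partial fractions give the difference. *)
Lemma lebesgue_measure_resonant_set (R : realType) k :
  (@lebesgue_measure R (resonant_set R k) <=
     (3 * ((k%:R + 1)^-1 - (k%:R + 2)^-1))%:E)%E.
Proof.
have k0 : 0 <= k%:R :> R by [].
have g0 := gap_gt0 R k.
have arcs (l : nat) :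
    (@lebesgue_measure R (resonant_arcs R k l) <= (6 * gap R k)%:E)%E.
  have l0 : 1 <= l.+1%:R :> R by rewrite ler1n.
  apply: (le_trans (Boole_inequality _ _)).
    by move=> j _; exact: measurable_realfun.measurable_ball.
  rewrite (eq_bigr (fun=> (gap R k / l.+1%:R *+ 2)%:E)); last first.
    by move=> j _; apply: lebesgue_measure_ball; rewrite divr_ge0// ltW.
  rewrite sumEFin lee_fin sumr_const card_ord -mulrnA -[leLHS]mulr_natr natrM natrD natrM.
  have -> : gap R k / l.+1%:R * (2 * (2 * l.+1%:R + 1)) =
    gap R k * (4 + 2 * l.+1%:R^-1) by field; lra.
  have : l.+1%:R^-1 <= 1 :> R by rewrite invf_le1//; lra.
  by move=> h; rewrite [leRHS]mulrC ler_pM2l//; move: h; move: (l.+1%:R^-1) => i; lra.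
apply: (le_trans (Boole_inequality _ _)).
  move=> l _; apply: bigsetU_measurable => j _; exact: measurable_realfun.measurable_ball.
apply: (@le_trans _ _ (\sum_(l < 2 ^ k) (6 * gap R k)%:E)%E).
  by apply: lee_sum => l _; exact: arcs.
rewrite sumEFin lee_fin sumr_const card_ord -[leLHS]mulr_natr natrX /gap.
have p0 : 0 < 2 ^+ k :> R by rewrite exprn_gt0.
rewrite le_eqVlt; apply/orP; left; apply/eqP; field.
by apply/and3P; split; lra.
Qed.

Lemma lebesgue_measure_resonant_sets (R : realType) :
  (@lebesgue_measure R (\bigcup_k resonant_set R k) <= 3%:E)%E.
Proof.
apply: (le_trans (generalized_Boole_inequality _ _ _)).
- by move=> k; exact: measurable_resonant_set.
- by apply: bigcup_measurable => k _; exact: measurable_resonant_set.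
apply: lime_le; first exact: is_cvg_nneseries.
apply: nearW => n.
apply: (@le_trans _ _
    (\sum_(0 <= k < n) (3 * ((k%:R + 1)^-1 - (k%:R + 2)^-1))%:E)%E).
  by apply: lee_sum => k _; exact: lebesgue_measure_resonant_set.
rewrite sumEFin lee_fin -mulr_sumr.
rewrite (@telescope_sumr_eq _ 0 n (fun k => - (k%:R + 1)^-1))//; last first.
  move=> k _; rewrite opprK addrC; congr (- _^-1 + _).
  by rewrite -(natr1 k); lra.
rewrite add0r invr1 opprK.
have : 0 <= (n%:R + 1)^-1 :> R by rewrite invr_ge0 addr_ge0.
lra.
Qed.

Lemma lebesgue_measure_nonresonant_set (R : realType) :
  (0 < @lebesgue_measure R (nonresonant_set R))%E.
Proof.
have hpi := @pi_ge2 R.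
have mU : measurable (\bigcup_k resonant_set R k).
  by apply: bigcup_measurable => k _; exact: measurable_resonant_set.
have mI := lebesgue_measure_circle R.
rewrite /nonresonant_set measureD//; last by rewrite [ltLHS]mI ltry.
rewrite [X in (X - _)%E]mI sube_gt0.
apply: (@le_lt_trans _ _ 3%:E).
  apply: le_trans (lebesgue_measure_resonant_sets R).
  by apply: le_measure; rewrite ?inE//; exact: measurableI.
by rewrite lte_fin; lra.
Qed.

Lemma nonresonant_gap (R : realType) (k l : nat) (t : R) :
  nonresonant_set R t -> (0 < l <= 2 ^ k)%N ->
  gap R k / 4 <= Normc.normc (expi l%:Z t - 1).
Proof.
case; rewrite /= in_itv /= => ht nt /andP[l0 lk].
have [j jl hj] := nearest_period _ l t l0 ht.
apply: le_trans (normc_expiB1_ge _ l%:Z (j%:Z - l%:Z) t hj).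
(* Were [l t] closer than [gap k] to a multiple of 2 pi, division by [l] would put [t] in the arc
   with indices [l.-1] and [j]. *)
rewrite ler_pM2r//; rewrite leNgt; apply/negP => hlt; apply: nt.
have lR : 0 < l%:R :> R by rewrite ltr0n.
exists k => //; rewrite /resonant_set -(bigcup_mkord _ (resonant_arcs R k)).
exists l.-1; first by rewrite /=; lia.
rewrite /resonant_arcs -(bigcup_mkord _ (resonant_arc R k l.-1)).
exists j; first by rewrite /= prednK.
rewrite /resonant_arc prednK// /ball /= ltr_pdivlMr// -{2}(gtr0_norm lR) -normrM.
rewrite distrC in hlt.
suff -> : (2 * pi * (j%:Z - l%:Z)%:~R / l%:R - t) * l%:R =
  2 * pi * (j%:Z - l%:Z)%:~R - l%:R * t :> R by [].
by field; lra.
Qed.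

(** * Exponential sums along a progression and the lower Riesz bound *)

Lemma measurable_normc_trig (R : realType) (D : set R) (s : seq int)
    (c : int -> R[i]) : measurable D ->
  measurable_fun D
    (fun t : R => Normc.normc (\sum_(lam <- s) c lam * expi lam t) ^+ 2 : R).
Proof.
move=> mD; apply: measurable_funS (@measurableT _ _) (@subsetT _ D) _.
apply: measurable_realfun.continuous_measurable_fun.
have cosc (a : int) : continuous (fun u : R => cos (a%:~R * u)).
  move=> t; apply: (@continuous_comp _ _ _ (fun u : R => a%:~R * u) cos).
    exact: mulrl_continuous.
  exact: continuous_cos.
have sinc (a : int) : continuous (fun u : R => sin (a%:~R * u)).
  move=> t; apply: (@continuous_comp _ _ _ (fun u : R => a%:~R * u) sin).
    exact: mulrl_continuous.
  exact: continuous_sin.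
pose re (r : seq int) (u : R) : R :=
  complex.Re (\sum_(lam <- r) c lam * expi lam u).
pose im (r : seq int) (u : R) : R :=
  complex.Im (\sum_(lam <- r) c lam * expi lam u).
have [rec imc] : continuous (re s) /\ continuous (im s).
  elim: s => [|a r [IHr IHi]].
    have -> : re [::] = cst 0 by apply/funext => u; rewrite /re big_nil.
    have -> : im [::] = cst 0 by apply/funext => u; rewrite /im big_nil.
    by split; exact: cst_continuous.
  have -> : re (a :: r) = fun u => complex.Re (c a) * cos (a%:~R * u)
      - complex.Im (c a) * sin (a%:~R * u) + re r u.
    apply/funext => u; rewrite /re big_cons raddfD; congr (_ + _).
    by case: (c a).
  have -> : im (a :: r) = fun u => complex.Re (c a) * sin (a%:~R * u)
      + complex.Im (c a) * cos (a%:~R * u) + im r u.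
    apply/funext => u; rewrite /im big_cons raddfD; congr (_ + _).
    by case: (c a).
  split=> t.
    apply: cvgD; last exact: IHr.
    apply: cvgB; apply: cvgM;
      by [exact: cvg_cst|exact: cosc|exact: sinc].
  apply: cvgD; last exact: IHi.
  apply: cvgD; apply: cvgM;
    by [exact: cvg_cst|exact: cosc|exact: sinc].
have -> : (fun t : R => Normc.normc (\sum_(lam <- s) c lam * expi lam t) ^+ 2 : R)
    = fun t => re s t * re s t + im s t * im s t.
  by apply/funext => t; rewrite normc_sqr !expr2.
move=> t; apply: cvgD; apply: cvgM;
  by [exact: rec|exact: imc].
Qed.

(** No constant is lost, since the normalised measure of [S] is at most 1. *)
Lemma L2norm2_trig_le (R : realType) (S : set R) (s : seq int)
    (c : int -> R[i]) (b : R) :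
  S `<=` [set t | - pi <= t < pi] -> measurable S -> 0 <= b ->
  (forall t, S t -> Normc.normc (\sum_(lam <- s) c lam * expi lam t) ^+ 2 <= b) ->
  (L2norm2_trig S s c <= b%:E)%E.
Proof.
move=> Spi mS b0 hb; have hpi := @pi_gt0 R.
have mI := lebesgue_measure_circle R.
have mS2 : (@lebesgue_measure R S <= (2 * pi)%:E)%E.
  by rewrite -mI; apply: le_measure; rewrite ?inE.
rewrite /L2norm2_trig.
apply: (@le_trans _ _ (((2 * pi)^-1)%:E * (b%:E * (2 * pi)%:E))%E).
  apply: lee_wpmul2l; first by rewrite lee_fin invr_ge0; lra.
  apply: (@le_trans _ _ (b%:E * @lebesgue_measure R S)%E); last first.
    by apply: lee_wpmul2l; rewrite ?lee_fin.
  rewrite -(integral_cst (@lebesgue_measure R) mS).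
  apply: ge0_le_integral => //.
  - by move=> t _; rewrite lee_fin sqr_ge0.
  - by apply/measurable_realfun.measurable_EFinP; exact: measurable_normc_trig.
rewrite -!EFinM lee_fin le_eqVlt; apply/orP; left; apply/eqP; field; lra.
Qed.

Lemma progression_bound (R : realType) (S : set R) (Lam : set int) (A d : R)
    (M : int) (N l m n : nat) :
  S `<=` [set t | - pi <= t < pi] -> measurable S -> 0 <= A ->
  (forall (s : seq int) (c : int -> R[i]), uniq s -> {subset s <= Lam} ->
    ((A * \sum_(lam <- s) Normc.normc (c lam) ^+ 2)%:E <= L2norm2_trig S s c)%E) ->
  (0 < l)%N -> (forall k, (1 <= k <= N)%N -> Lam (M + (k * l)%:Z)) ->
  (0 < m)%N -> (0 < n)%N -> (n * m <= N)%N -> 0 < d ->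
  (forall t, S t -> d <= Normc.normc (expi l%:Z t - 1)) ->
  A * (n%:R * d) ^+ (2 * m) <= N%:R * 2 ^+ (2 * m).
Proof.
move=> Spi mS A0 hA l0 hLam m0 n0 nmN d0 hd.
pose P : {poly R[i]} := (\sum_(i < n) 'X^i) ^+ m.
(* The degree is at most [(n - 1) m], so [(n - 1) m + 1 <= n m] coefficients suffice. *)
have sizeP : (size P <= N)%N.
  apply: (leq_trans (size_poly_exp_leq _ _)).
  have : (size (\sum_(i < n) 'X^i : {poly R[i]})%R <= n)%N.
    apply: (leq_trans (size_sum _ _ _)); apply/bigmax_leqP => i _.
    by rewrite size_polyXn.
  by move=> h; nia.
have hornerP z : P.[z] = (\sum_(i < n) z ^+ i) ^+ m.
  rewrite /P horner_exp horner_sum; congr (_ ^+ _).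
  by apply: eq_bigr => i _; rewrite hornerXn.
pose f (k : nat) : int := M + (k.+1 * l)%:Z.
have f_inj : injective f by move=> i j; rewrite /f; nia.
pose s := map f (iota 0 N).
(* The coefficient of [P] is found from the position of the frequency in the progression; off it the
   index is [N], where [P] has coefficient 0. *)
pose c (lam : int) : R[i] := P`_(index lam s).
have cE k : (k < N)%N -> c (f k) = P`_k.
  move=> kN; rewrite /c /s index_map//; congr (P`_ _).
  have := @index_uniq _ 0%N k (iota 0 N).
  by rewrite size_iota nth_iota// add0n => -> //; exact: iota_uniq.
have sumE (F : int -> R[i] -> R[i]) :
  \sum_(lam <- s) F lam (c lam) = \sum_(k < N) F (f k) P`_k.
  rewrite /s big_map -{1}(subn0 N) big_mkord.
  by apply: eq_bigr => k _; rewrite cE.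
have us : uniq s by rewrite map_inj_uniq ?iota_uniq.
have sLam : {subset s <= Lam}.
  move=> x /mapP[k]; rewrite mem_iota add0n => kN ->; rewrite inE.
  by apply: hLam.
have trigE t : Normc.normc (\sum_(lam <- s) c lam * expi lam t) =
    Normc.normc (\sum_(i < n) expi l%:Z t ^+ i) ^+ m.
  rewrite (sumE (fun lam x => x * expi lam t)).
  (* The first frequency [M + l] factors out with modulus 1, leaving [P] evaluated at [expi l t]. *)
  rewrite (eq_bigr (fun k : 'I_N => expi (M + l%:Z) t * (P`_k * expi l%:Z t ^+ k))).
    rewrite -mulr_sumr Normc.normcM normc_expi mul1r -horner_coef_wide//.
    by rewrite hornerP normcX.
  move=> k _; rewrite /f mulSn PoszD addrA (expiD _ (M + l%:Z)) expiMn; ring.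
have upper : (L2norm2_trig S s c <= ((2 / d) ^+ (2 * m))%:E)%E.
  apply: L2norm2_trig_le => //; first by rewrite exprn_ge0// divr_ge0// ltW.
  move=> t St; rewrite trigE -exprM mulnC.
  apply: lerXn2r; rewrite ?nnegrE ?normc_ge0//.
    by rewrite divr_ge0// ltW.
  rewrite ler_pdivlMr//.
  apply: le_trans _ (normc_geometric_sum _ _ n (normc_expi _ l%:Z t)).
  by rewrite ler_wpM2l ?normc_ge0//; exact: hd.
have := le_trans (hA s c us sLam) upper; rewrite lee_fin.
have -> : \sum_(lam <- s) Normc.normc (c lam) ^+ 2 =
    \sum_(k < N) Normc.normc P`_k ^+ 2.
  rewrite /s big_map -{1}(subn0 N) big_mkord.
  by apply: eq_bigr => k _; rewrite cE.
set sq := \sum_(k < N) _ => hsq.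
(* The coefficients of [P] sum to [P.[1] = n ^+ m]; Cauchy-Schwarz is applied to their moduli. *)
have lower : n%:R ^+ (2 * m) <= N%:R * sq.
  apply: le_trans (sqr_sum_le _ _ _); rewrite mulnC exprM.
  apply: lerXn2r; rewrite ?nnegrE ?exprn_ge0//.
    by apply: sumr_ge0 => k _; exact: normc_ge0.
  have -> : n%:R ^+ m = Normc.normc P.[1].
    rewrite hornerP normcX (eq_bigr (fun=> 1)) => [|i _]; last by rewrite expr1n.
    by rewrite sumr_const card_ord normc_nat.
  rewrite (horner_coef_wide _ sizeP).
  apply: (le_trans (normc_sum _ _ _ _)); rewrite le_eqVlt; apply/orP; left.
  by apply/eqP; apply: eq_bigr => k _; rewrite expr1n mulr1.
have dp : 0 < d ^+ (2 * m) by rewrite exprn_gt0.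
rewrite expr_div_n ler_pdivlMr// in hsq.
rewrite exprMn; have N0 : 0 <= N%:R :> R by [].
apply: (@le_trans _ _ (A * (N%:R * sq * d ^+ (2 * m)))).
  by rewrite ler_wpM2l// ler_wpM2r// ltW.
have -> : A * (N%:R * sq * d ^+ (2 * m)) = N%:R * (A * sq * d ^+ (2 * m)) by ring.
by rewrite ler_wpM2l.
Qed.

(** * Size of the gap relative to the length of the progression *)

Lemma quadratic_le_powR (R : realType) (e : R) : 0 < e ->
  exists2 K : R, 0 < K & forall k : nat,
    (k%:R + 1) * (k%:R + 2) <= K * (2 ^+ k) `^ e.
Proof.
move=> e0; have ln2 : 0 < ln (2 : R) by rewrite ln_gt0// ltr1n.
(* With this [a], 2^(k e) is the square of [expR (a * k)], and [1 + a k <= expR (a * k)] dominates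
   [k + 2] up to the factor [2 + a^-1]. *)
pose a : R := e * ln 2 / 2.
have a0 : 0 < a by rewrite /a; do ?apply: mulr_gt0 => //; rewrite invr_gt0.
have ai0 : 0 < a^-1 by rewrite invr_gt0.
exists ((2 + a^-1) ^+ 2) => [|k]; first by rewrite exprn_gt0// addr_gt0.
have k0 : 0 <= k%:R :> R by [].
have -> : (2 ^+ k) `^ e = expR (a * k%:R) ^+ 2.
  rewrite -(@powR_mulrn _ 2)// -powRrM /powR pnatr_eq0 /= -expRM_natl.
  by congr expR; rewrite /a; field.
rewrite -exprMn.
apply: (@le_trans _ _ ((k%:R + 2) ^+ 2)); first by nra.
have hexp := expR_ge1Dx (a * k%:R).
have hk : k%:R + 2 <= (2 + a^-1) * (1 + a * k%:R).
  have -> : (2 + a^-1) * (1 + a * k%:R) = 2 + k%:R + a^-1 + 2 * (a * k%:R).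
    by field; lra.
  have : 0 <= a * k%:R by rewrite mulr_ge0// ltW.
  lra.
apply: lerXn2r; rewrite ?nnegrE; first lra.
  by rewrite mulr_ge0// ?expR_ge0//; lra.
apply: (le_trans hk); rewrite ler_wpM2l//; lra.
Qed.

(** Up to constants the inverse gap is at most 2^(k (1 + e)), and 2^k is of the order of [l], so it
    is at most of order N^(alpha (1 + e)). The choice of [e] keeps this below N^(1 - e). *)
Lemma gap_decay (R : realType) (alpha C : R) : alpha < 1 -> 0 < C ->
  exists2 K : R, 0 < K & forall N l : nat, (0 < N)%N -> (0 < l)%N ->
    l%:R <= C * N%:R `^ alpha ->
    N%:R `^ ((1 - alpha) / 2) <= K * (N%:R * gap R (up_log 2 l)).
Proof.
move=> alpha1 C0; set e := (1 - alpha) / 2.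
have e0 : 0 < e by rewrite /e; lra.
have [K0 K00 hK0] := quadratic_le_powR _ _ e0.
pose Q : R := (2 * C) `^ (1 + e).
have Q0 : 0 < Q by rewrite powR_gt0// mulr_gt0.
exists (2 * (K0 * Q)) => [|N l N0 l0 hl]; first by rewrite !mulr_gt0.
set k := up_log 2 l.
have NR : 1 <= N%:R :> R by rewrite ler1n.
have Ngt0 : 0 < N%:R :> R by lra.
have k0 : 0 <= k%:R :> R by [].
have x0 : 0 < 2 ^+ k :> R by rewrite exprn_gt0.
have xl : 2 ^+ k <= 2 * l%:R :> R.
  rewrite -natrX -natrM ler_nat /k.
  case: (ltnP 1 l) => hl1; last by rewrite (_ : l = 1%N)// ?up_log1//; lia.
  have := up_log_gtn (erefl (1 < 2)%N) hl1.
  have : (0 < up_log 2 l)%N by rewrite up_log_gt0.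
  by case: (up_log 2 l) => // q _ /=; rewrite expnS; lia.
have xQ : (2 ^+ k) `^ (1 + e) <= Q * N%:R `^ (1 - e).
  apply: (@le_trans _ _ ((2 * C * N%:R `^ alpha) `^ (1 + e))).
    apply: ge0_ler_powR; rewrite ?nnegrE.
    - by lra.
    - exact: ltW.
    - by rewrite !mulr_ge0 ?powR_ge0// ltW.
    - by apply: (le_trans xl); rewrite -mulrA ler_pM2l.
  rewrite powRM ?powR_ge0//; last by rewrite mulr_ge0// ltW.
  rewrite -powRrM ler_pM2l//; apply: ler_powR => //.
  (* Since [alpha = 1 - 2 e], the exponent is [alpha (1 + e) = 1 - e - 2 e^2]. *)
  by rewrite /e; nra.
have key : 2 ^+ k * ((k%:R + 1) * (k%:R + 2)) <= K0 * Q * N%:R `^ (1 - e).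
  apply: (@le_trans _ _ (2 ^+ k * (K0 * (2 ^+ k) `^ e))).
    by rewrite ler_pM2l.
  rewrite mulrCA -{1}(powRr1 (ltW x0)) -powRD; last by rewrite lt0r_neq0 ?implybT.
  by rewrite -mulrA ler_pM2l.
have g0 : 0 < 2 * 2 ^+ k * (k%:R + 1) * (k%:R + 2) :> R.
  by rewrite !mulr_gt0//; lra.
rewrite /gap [leRHS]mulrA ler_pdivlMr//.
have NE : N%:R `^ e * N%:R `^ (1 - e) = N%:R :> R.
  rewrite -powRD; last by rewrite lt0r_neq0 ?implybT.
  by rewrite addrC subrK powRr1// ltW.
have -> : 2 * (K0 * Q) * N%:R = N%:R `^ e * (2 * (K0 * Q * N%:R `^ (1 - e))).
  by rewrite -{1}NE; ring.
rewrite ler_pM2l ?powR_gt0//; lra.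
Qed.

(** * The contradiction for long progressions *)

Theorem theorem1 (R : realType) :
  exists S : set R,
    S `<=` [set t | - pi <= t < pi] /\ measurable S /\ (0 < @lebesgue_measure R S)%E /\
    forall (alpha : R) (Lam : set int),
      alpha < 1 ->
      (exists C : R, 0 < C /\
         forall N0 : nat, exists N : nat, (N0 <= N)%N /\
           exists (M : int) (l : nat), (0 < l)%N /\
             (l%:R <= C * (N%:R `^ alpha)) /\
             (forall k : nat, (1 <= k <= N)%N -> Lam (M + (k * l)%:Z))) ->
      ~ riesz_seq_exp S Lam.
Proof.
have Spi : nonresonant_set R `<=` [set t | - pi <= t < pi].
  by move=> t []; rewrite /= in_itv.
exists (nonresonant_set R); split=> //.
split; first exact: measurable_nonresonant_set.
split; first exact: lebesgue_measure_nonresonant_set.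
move=> alpha Lam alpha1 [C [C0 hC]] [A [B [A0 [B0 hAB]]]].
have [K K0 hK] := gap_decay _ _ _ alpha1 C0.
set e := (1 - alpha) / 2 in hK; have e0 : 0 < e by rewrite /e; lra.
(* With [m e >= 1], the power [2 m] turns N^e into at least N^2, which beats the factor [N] lost to
   Cauchy-Schwarz. *)
pose m := (Num.bound e^-1).+1.
have me : 1 <= m%:R * e.
  rewrite -ler_pdivrMr// mul1r; apply: (@le_trans _ _ (Num.bound e^-1)%:R).
    by apply: ltW; apply: archi_boundP; rewrite invr_ge0 ltW.
  by rewrite ler_nat.
have m0 : 0 < m%:R :> R by rewrite ltr0n.
(* The 8 is 4 from [gap R k / 4] times 2 from [N <= 2 m n]. *)
pose L : R := 8 * m%:R * K.
have L0 : 0 < L by rewrite /L !mulr_gt0.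
(* The final inequality will read [N <= b], so [N] is taken beyond [b], and at least [m] to make [n]
   positive. *)
pose b : R := (2 * L) ^+ (2 * m) / A.
have b0 : 0 <= b by rewrite /b divr_ge0 ?exprn_ge0 ?mulr_ge0// ltW.
have [N [NN0 [M [l [l0 [hl hLam]]]]]] := hC (m + Num.bound b)%N.
have mN : (m <= N)%N by lia.
have bN : b < N%:R.
  apply: (lt_le_trans (archi_boundP b0)); rewrite ler_nat; lia.
have N0 : (0 < N)%N by rewrite /m in mN; lia.
have Ngt0 : 0 < N%:R :> R by rewrite ltr0n.
pose n := (N %/ m)%N.
have n0 : (0 < n)%N by rewrite divn_gt0.
have nmN : (n * m <= N)%N by exact: leq_trunc_div.
(* [N < (n + 1) m], and [n + 1 <= 2 n]. *)
have Nn : N%:R <= 2 * m%:R * n%:R :> R.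
  rewrite -!natrM ler_nat.
  have := ltn_ceil N (ltn0Sn (Num.bound e^-1)); rewrite -/m -/n; nia.
set k := up_log 2 l; have g0 := gap_gt0 R k.
have := @progression_bound R (nonresonant_set R) Lam A (gap R k / 4) M N l m n
  Spi (measurable_nonresonant_set R) (ltW A0)
  (fun s c us sL => (hAB s c us sL).1) l0 hLam (ltn0Sn _) n0 nmN.
rewrite divr_gt0// => /(_ isT) /=.
have hgap t : nonresonant_set R t ->
    gap R k / 4 <= Normc.normc (expi l%:Z t - 1).
  by move=> St; apply: nonresonant_gap => //; rewrite l0 up_logP.
move=> /(_ hgap) hmain.
have hKN := hK N l N0 l0 hl; rewrite -/k in hKN.
have hNe : N%:R `^ e <= L * (n%:R * (gap R k / 4)).
  apply: (le_trans hKN).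
  have -> : L * (n%:R * (gap R k / 4)) = K * (2 * m%:R * n%:R * gap R k).
    by rewrite /L; field.
  by rewrite ler_pM2l// ler_pM2r.
have hN2 : N%:R ^+ 2 <= (N%:R `^ e) ^+ (2 * m).
  rewrite -!powR_mulrn ?powR_ge0 ?ler0n// -powRrM; apply: ler_powR.
    by rewrite ler1n.
  by rewrite natrM; nra.
have h1 : N%:R ^+ 2 <= L ^+ (2 * m) * (n%:R * (gap R k / 4)) ^+ (2 * m).
  apply: (le_trans hN2); rewrite -exprMn; apply: lerXn2r; rewrite ?nnegrE ?powR_ge0//.
  by rewrite !mulr_ge0// ltW.
have h2 : A * N%:R ^+ 2 <= N%:R * (2 * L) ^+ (2 * m).
  apply: (@le_trans _ _ (L ^+ (2 * m) * (A * (n%:R * (gap R k / 4)) ^+ (2 * m)))).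
    by rewrite [leRHS]mulrCA ler_pM2l.
  rewrite [(2 * L) ^+ _]exprMn [leRHS]mulrA [leRHS]mulrC ler_pM2l//.
  by rewrite exprn_gt0.
move: h2; rewrite expr2 mulrCA ler_pM2l// mulrC -ler_pdivlMr// -/b.
by rewrite leNgt bN.
Qed.
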